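(* The closed-form retraction $R_u(\xi_u):=\psi(u+\xi_u)$, $u\in\mathcal{M}$, $\xi_u\in T_u\mathcal{M}$ (defined for $u+\xi_u\in S$), is a well-defined retraction on $\mathcal{M}$. That is, $R$ is a well-defined smooth map into $\mathcal{M}$ on the open neighborhood $\{(u,\xi_u)\in T\mathcal{M} : u+\xi_u\in S\}$ of the zero section, and for every $u\in\mathcal{M}$: (i) $R_u(0_u)=u$; (ii) $\mathrm{D}R_u(0_u)=\mathrm{id}_{T_u\mathcal{M}}$.
   Context: Let $F\ge 1$ be an integer, $n$ a positive even integer, $N=2n(2F+1)$, and let $M$ be a real number with $0\le M<F$ and $M\notin\mathbb{Z}$. Vectors $w\in\mathbb{R}^N$ are written in blocks $w=(w_F;w_{F-1};\dots;w_{-F})$ with $w_l\in\mathbb{R}^{2n}$, the index $l$ ranging over the integers from $-F$ to $F$. Let $\Gamma=\mathrm{diag}(F I_{2n},(F-1)I_{2n},\dots,I_{2n},0,-I_{2n},\dots,-F I_{2n})\in\mathbb{R}^{N\times N}$, so $(\Gamma w)_l=l\,w_l$. Define $$\mathcal{M}=\{u\in\mathbb{R}^N : u^Tu=1,\ u^T\Gamma u=M\},$$ a closed embedded submanifold of $\mathbb{R}^N$ of dimension $N-2$, with tangent space $T_u\mathcal{M}=\{\xi\in\mathbb{R}^N : u^T\xi=0,\ u^T\Gamma\xi=0\}$, and $$S=\{w\in\mathbb{R}^N : w^T\Gamma^2w-(M+l)\,w^T\Gamma w+Ml\,w^Tw>0\ \text{ for } l=F \text{ and } l=-F\},$$ an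 open set containing $\mathcal{M}$. For $w\in S$, $\psi(w)\in\mathcal{M}$ is defined by $\psi(w)_l=\sigma_l w_l$ with positive coefficients of the form $\sigma_l=\sqrt{1+2\mu+2l\lambda}$, $l=F,\dots,-F$, where the real numbers $\mu,\lambda$ (depending on $w$) are determined by the constraints $$\sum_{l=-F}^F\|w_l\|_2^2\sigma_l^2=1,\qquad \sum_{l=-F}^F l\,\|w_l\|_2^2\sigma_l^2=M.$$ A retraction on $\mathcal{M}$ is a smooth mapping $R$ from the tangent bundle $T\mathcal{M}$ (here: from a neighborhood of its zero section) to $\mathcal{M}$ such that, with $R_u$ the restriction of $R$ to $T_u\mathcal{M}$ and $0_u$ the zero of $T_u\mathcal{M}$, $R_u(0_u)=u$ and, under the canonical identification $T_{0_u}T_u\mathcal{M}\simeq T_u\mathcal{M}$, $\mathrm{D}R_u(0_u)=\mathrm{id}_{T_u\mathcal{M}}$. *)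

(* Defs.v *)
From HB Require Import structures.
From mathcomp Require Import all_boot all_order all_algebra.
From mathcomp Require Import all_classical all_reals all_analysis.

Set Implicit Arguments.
Unset Strict Implicit.
Unset Printing Implicit Defensive.

Import Order.TTheory GRing.Theory Num.Theory.
Import numFieldNormedType.Exports.

Local Open Scope classical_set_scope.
Local Open Scope ring_scope.

Section Smoothness.
Context {R : realType}.
Implicit Types V W : normedModType R.

(* f is of class C^k on the open set U. In finite dimension this is the
   usual notion: f is C^(k+1) iff all its directional derivatives are C^k. *)
Fixpoint class_C V W (k : nat) (U : set V) (f : V -> W) : Prop :=
  match k with
  | 0 => forall x, U x -> {for x, continuous f}
  | k'.+1 => (forall x, U x -> differentiable f x) /\
             (forall v : V, class_C k' U (fun x => 'D_v f x))
  end.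

(* Smoothness of a map on an arbitrary subset A of a normed space: f locally
   extends to a C^oo map on an open set of the ambient space. When A is an
   embedded submanifold (or a relatively open part of one), this is the usual
   smoothness of a map on a manifold; and a map into an embedded submanifold
   is smooth iff it is smooth as a map into the ambient space. *)
Definition smooth_on V W (A : set V) (f : V -> W) : Prop :=
  forall x, A x -> exists (U : set V) (g : V -> W),
    [/\ open U, U x, (forall k, class_C k U g) &
        forall y, U y -> A y -> g y = f y].

(* L is the Frechet derivative at 0 of the restriction of f to the linear
   subspace T; this only involves the values of f on T. *)
Definition has_differential0 V W (T : set V) (f : V -> W)
    (L : {linear V -> W}) : Prop :=
  (fun h : V => f h - f 0 - L h) =o_ (within T (nbhs (0 : V))) (fun h : V => h).

Section Retraction.
Variables (V : normedModType R) (X : set V) (T : V -> set V).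

Definition tangent_bundle : set (V * V) := [set p | X p.1 /\ T p.1 p.2].

(* Rt u is R_u; Rt is a retraction defined on the neighborhood D of the zero
   section of the tangent bundle of the submanifold X whose tangent space at u
   is T u. Values of Rt outside D are irrelevant. *)
Definition is_retraction (D : set (V * V)) (Rt : V -> V -> V) : Prop :=
  [/\ (exists2 O : set (V * V), open O & D = tangent_bundle `&` O),
      (forall u, X u -> D (u, 0)),
      (forall u xi, D (u, xi) -> X (Rt u xi)),
      smooth_on D (fun p => Rt p.1 p.2) &
      forall u, X u ->
        Rt u 0 = u /\
        has_differential0 (T u) (Rt u) (idfun : {linear V -> V})].
End Retraction.
End Smoothness.

Section Spinor.
Context {R : realType}.
Variables (F n : nat) (M : R).

Definition dimN : nat := \sum_(i < (2 * F).+1) 2 * n.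

Lemma dimNE : dimN = (2 * n * (2 * F + 1))%N.
Proof. by rewrite /dimN sum_nat_const card_ord addn1 mulnC. Qed.

(* The i-th block from the top carries the index l = F - i. *)
Definition lvl (i : 'I_(2 * F).+1) : R := F%:R - (i : nat)%:R.

Definition block (w : 'cV[R]_dimN) (i : 'I_(2 * F).+1) : 'cV[R]_(2 * n) :=
  submxcol w i.

Definition sqnorm m (x : 'cV[R]_m) : R := \sum_j x j 0 ^+ 2.

Definition Gam : 'M[R]_dimN :=
  \mxdiag_(i < (2 * F).+1) ((lvl i)%:M : 'M[R]_(2 * n)).

Definition scal1 (A : 'M[R]_1) : R := A 0 0.

Definition manifold : set 'cV[R]_dimN :=
  [set u | scal1 (u^T *m u) = 1 /\ scal1 (u^T *m Gam *m u) = M].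

Definition tangent (u : 'cV[R]_dimN) : set 'cV[R]_dimN :=
  [set xi | scal1 (u^T *m xi) = 0 /\ scal1 (u^T *m Gam *m xi) = 0].

Definition Sform (l : R) (w : 'cV[R]_dimN) : R :=
  scal1 (w^T *m (Gam *m Gam) *m w) - (M + l) * scal1 (w^T *m Gam *m w)
  + M * l * scal1 (w^T *m w).

Definition Sset : set 'cV[R]_dimN :=
  [set w | 0 < Sform F%:R w /\ 0 < Sform (- F%:R) w].

(* p = (mu, lambda). Num.sqrt is 0 on nonpositive reals, hence 0 < sigma p i
   forces the radicand to be positive. *)
Definition sigma (p : R * R) (i : 'I_(2 * F).+1) : R :=
  Num.sqrt (1 + 2 * p.1 + 2 * lvl i * p.2).

Definition psi_params (w : 'cV[R]_dimN) : set (R * R) :=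
  [set p | [/\ forall i, 0 < sigma p i,
               \sum_i sqnorm (block w i) * sigma p i ^+ 2 = 1 &
               \sum_i lvl i * sqnorm (block w i) * sigma p i ^+ 2 = M]].

(* get picks an element of psi_params w when there is one. *)
Definition psi (w : 'cV[R]_dimN) : 'cV[R]_dimN :=
  \mxcol_(i < (2 * F).+1) (sigma (get (psi_params w)) i *: block w i).

Definition retr (u xi : 'cV[R]_dimN) : 'cV[R]_dimN := psi (u + xi).

Definition retr_dom : set ('cV[R]_dimN * 'cV[R]_dimN) :=
  [set p | tangent_bundle manifold tangent p /\ Sset (p.1 + p.2)].
End Spinor.

(* Main.v *)
Require Import Defs.
From HB Require Import structures.
From mathcomp Require Import all_boot all_order all_algebra.
From mathcomp Require Import all_classical all_reals all_analysis.
From mathcomp Require Import ring lra.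
Import Order.TTheory GRing.Theory Num.Theory.
Import numFieldNormedType.Exports.
Local Open Scope classical_set_scope.
Local Open Scope ring_scope.
Set Implicit Arguments.
Unset Strict Implicit.
Unset Printing Implicit Defensive.

(** Write [N_k = \sum_l l^k |w_l|^2]. With [alpha = 1 + 2 mu] and
    [beta = 2 lambda] one has [sigma_l^2 = alpha + l beta], so the two
    constraints defining [psi w] form a linear system

      [alpha N_0 + beta N_1 = 1],   [alpha N_1 + beta N_2 = M],

    whose determinant is [D = N_0 N_2 - N_1^2]. Cramer's rule gives the only
    candidate, and for it [sigma_l^2 = Q_l / D], where
    [Q_l = N_2 - (M + l) N_1 + M l N_0] is precisely the form [Sform] used to
    define the set [S]. The positivity conditions come from the fact that [Q_l]
    is affine in [l]. Each level [l] lies in [[-F, F]], hence [Q_l > 0] as soon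
    as [Q_F] and [Q_(-F)] are positive ([Sform_lvl_gt0]). Moreover, the identity

      [2 F D = (F N_0 + N_1) Q_F + (F N_0 - N_1) Q_(-F)]

    expresses [D] as a nonnegative combination of the same two numbers
    ([disc_gt0]). So [psi] is well defined on [S], and there it coincides with
    the closed formula [w_l |-> sqrt (Q_l / D) w_l] ([psiE]).

    Smoothness of this formula follows from closure of the C^k classes under
    sums, products, inverses and square roots of positive functions, proved by
    induction on [k]; composition with the linear map [(u, xi) |-> u + xi]
    then gives the smoothness of the retraction.

    On the manifold, [N_0 = 1] and [N_1 = M], so every [Q_l] equals [D]. The
    value [D = \sum_l (l - M)^2 |u_l|^2] is positive because [M] is not an
    integer; thus the manifold lies in [S] and [psi] fixes it. Finally, a
    tangent direction lies in the kernels of the differentials of [N_0] and [N_1], so that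
    [Q_l] and [D] have the same derivative along it (that of [N_2]); since also
    [Q_l = D], the quotient [Q_l / D] is stationary. To first order the
    coefficients [sigma_l] therefore stay equal to 1 in tangent directions, and
    the differential of [psi] restricts to the identity there
    ([derive_psi_closed]). *)

(** * Calculus of maps of class C^k on open sets *)

Section Calculus.
Context {R : realType}.
Implicit Types (V W X : normedModType R) (k : nat).

(** The differential is chosen by [get], so this is not immediate: the expansion
    of [f] at [x] transfers to [g], and uniqueness of the differential
    identifies the chosen one for [g]. *)
Lemma differentiable_near_eq V W (f g : V -> W) (x : V) :
  (\near x, f x = g x) -> differentiable f x -> differentiable g x.
Proof.
move=> fg df; have fgx : f x = g x by exact: nbhs_singleton fg.
have [cd dfE] := (diff_locallyP x f).1 df.
have gE : g \o shift x = cst (g x) + 'd f x +o_ (0 : V) id.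
  apply/eqaddoP => e e0; move/eqaddoP: dfE => /(_ _ e0) dfE.
  have fg0 : \forall h \near 0, f (h + x) = g (h + x).
    by move: fg; rewrite (near_shift 0) subr0.
  near=> h; have <- : (f \o shift x - (cst (f x) + 'd f x)) h =
    (g \o shift x - (cst (g x) + 'd f x)) h.
    by rewrite !fctE/= fgx; congr (_ - _); near: h.
  by near: h.
by apply/diff_locallyP; rewrite (diff_unique cd gE).
Unshelve. all: by end_near. Qed.

(** The product, inverse and square root rules below identify directional
    derivatives only at the points of [U]. Since [U] is open, such an identity
    also determines the further derivatives there, so the induction on [k]
    can continue. *)
Lemma class_C_eq V W k (U : set V) (f g : V -> W) : open U ->
  (forall x, U x -> f x = g x) -> class_C k U f -> class_C k U g.
Proof.
move=> oU; elim: k f g => [|k IH] f g fg /=.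
  move=> cf x Ux; rewrite /prop_for /continuous_at -(fg x Ux).
  apply: cvg_trans (cf x Ux); apply: near_eq_cvg.
  by near=> y; apply: fg; near: y; exact: open_nbhs_nbhs.
have nfg x : U x -> \near x, f x = g x.
  by move=> Ux; near=> y; apply: fg; near: y; exact: open_nbhs_nbhs.
move=> [df Df]; split=> [x Ux|v].
  exact: differentiable_near_eq (nfg _ Ux) (df _ Ux).
by apply: IH (Df v) => x Ux; apply: near_eq_derive (nfg _ Ux).
Unshelve. all: by end_near. Qed.

Lemma class_CS V W k (U : set V) (f : V -> W) :
  class_C k.+1 U f -> class_C k U f.
Proof.
elim: k f => [f [df _] x Ux|k IH f [df Df]].
  exact: differentiable_continuous (df x Ux).
by split=> // v; apply: IH.
Qed.

Lemma class_C_cst V W k (U : set V) (a : W) : class_C k U (cst a).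
Proof.
elim: k a => [a x _|k IH a]; first exact: cst_continuous.
split=> [x _|v]; first exact: differentiable_cst.
have -> : (fun x => 'D_v (cst a : V -> W) x) = cst 0.
  by apply/funext => x; rewrite derive_cst.
exact: IH.
Qed.

Lemma class_C_linear V W k (U : set V) (f : {linear V -> W}) :
  continuous f -> class_C k U f.
Proof.
move=> cf; case: k => [x _|k]; first exact: cf.
split=> [x _|v]; first exact: linear_differentiable.
have -> : (fun x => 'D_v f x) = cst (f v).
  apply/funext => x; rewrite deriveE; last exact: linear_differentiable.
  by rewrite diff_lin.
exact: class_C_cst.
Qed.

Lemma class_CD V W k (U : set V) (f g : V -> W) : open U ->
  class_C k U f -> class_C k U g -> class_C k U (f \+ g).
Proof.
move=> oU; elim: k f g => [|k IH] f g.
  by move=> cf cg x Ux; apply: continuousD; [exact: cf|exact: cg].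
move=> [df Df] [dg Dg]; split=> [x Ux|v].
  by apply: differentiableD; [exact: df|exact: dg].
apply: class_C_eq (IH _ _ (Df v) (Dg v)) => // x Ux /=.
by rewrite deriveD//; apply: diff_derivable; [exact: df|exact: dg].
Qed.

Lemma class_C_sum V W k (U : set V) (I : Type) (r : seq I) (f : I -> V -> W) :
  open U -> (forall i, class_C k U (f i)) ->
  class_C k U (fun x => \sum_(i <- r) f i x).
Proof.
move=> oU Cf; elim: r => [|i r IH].
  by apply: (class_C_eq oU _ (class_C_cst _ _ 0)) => x _; rewrite big_nil.
by apply: (class_C_eq oU _ (class_CD oU (Cf i) IH)) => x _; rewrite big_cons.
Qed.

(** Each term of the product rule for [f \* g] contains an undifferentiated
    factor, which has to be weakened from C^(k+1) to C^k by [class_CS] before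
    the induction hypothesis applies. *)
Lemma class_CM V k (U : set V) (f g : V -> R) : open U ->
  class_C k U f -> class_C k U g -> class_C k U (f \* g).
Proof.
move=> oU; elim: k f g => [|k IH] f g.
  by move=> cf cg x Ux; apply: continuousM; [exact: cf|exact: cg].
move=> Cf Cg; have [df Df] := Cf; have [dg Dg] := Cg; split=> [x Ux|v].
  by apply: differentiableM; [exact: df|exact: dg].
have C1 := class_CD oU (IH _ _ (class_CS Cf) (Dg v))
                       (IH _ _ (class_CS Cg) (Df v)).
apply: class_C_eq C1 => // x Ux /=.
by rewrite deriveM//; apply: diff_derivable; [exact: df|exact: dg].
Qed.

(** The derivative of [1/f] is [- f' (1/f)^2]: it involves only [f'] and [1/f]
    itself, which is C^k by induction. The square root below is treated in the
    same way, through [(sqrt f)' = f' / (2 sqrt f)]. *)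
Lemma class_CV V k (U : set V) (f : V -> R) : open U ->
  (forall x, U x -> f x != 0) ->
  class_C k U f -> class_C k U (fun x => (f x)^-1).
Proof.
move=> oU f0; elim: k => [|k IH].
  by move=> cf x Ux; apply: cvgV; [exact: f0|exact: cf].
move=> Cf; have [df Df] := Cf; have CV := IH (class_CS Cf).
split=> [x Ux|v].
  by apply: differentiableV; [exact: df|exact: f0].
have C1 := class_CM oU (class_C_cst k U (-1 : R))
  (class_CM oU (Df v) (class_CM oU CV CV)).
apply: class_C_eq C1 => // x Ux /=.
rewrite deriveV; [|exact: f0|by apply: diff_derivable; exact: df].
by rewrite /cst /= /GRing.scale /= -exprVn expr2; ring.
Qed.

Lemma differentiable_sqrt V (f : V -> R) (x : V) : 0 < f x ->
  differentiable f x -> differentiable (fun y => Num.sqrt (f y)) x.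
Proof.
move=> fx0 df; apply: (@differentiable_comp _ _ _ _ f Num.sqrt) => //.
by apply/derivable1_diffP; case: (is_derive1_sqrt fx0).
Qed.

Lemma derive_sqrt_comp V (f : V -> R) (x v : V) : 0 < f x ->
  differentiable f x ->
  'D_v (fun y => Num.sqrt (f y)) x = 'D_v f x * (2 * Num.sqrt (f x))^-1.
Proof.
move=> fx0 df.
have ds : differentiable (@Num.sqrt R) (f x).
  by apply/derivable1_diffP; case: (is_derive1_sqrt fx0).
rewrite deriveE; last exact: differentiable_sqrt.
rewrite (@diff_comp _ _ _ _ f Num.sqrt)//= deriv1E; last first.
  by case: (is_derive1_sqrt fx0).
by rewrite derive1E derive_sqrt// deriveE.
Qed.

Lemma class_C_sqrt V k (U : set V) (f : V -> R) : open U ->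
  (forall x, U x -> 0 < f x) ->
  class_C k U f -> class_C k U (fun x => Num.sqrt (f x)).
Proof.
move=> oU f0; elim: k => [|k IH].
  move=> cf x Ux.
  by apply: continuous_comp; [exact: cf|exact: sqrt_continuous].
move=> Cf; have [df Df] := Cf; have CS := IH (class_CS Cf).
split=> [x Ux|v].
  by apply: differentiable_sqrt; [exact: f0|exact: df].
have C2 : class_C k U (fun x => (2 * Num.sqrt (f x))^-1).
  apply: class_CV => // [x Ux|].
    by rewrite gt_eqF// mulr_gt0// sqrtr_gt0 f0.
  exact: class_CM (class_C_cst _ _ _) CS.
apply: class_C_eq (class_CM oU (Df v) C2) => // x Ux /=.
by rewrite derive_sqrt_comp//; [exact: f0|exact: df].
Qed.

Lemma class_CZl V W k (U : set V) (f : V -> R) (a : W) : open U ->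
  class_C k U f -> class_C k U (fun x => f x *: a).
Proof.
move=> oU; elim: k f => [|k IH] f.
  by move=> cf x Ux; apply: cvgZr_tmp; exact: cf.
move=> [df Df]; split=> [x Ux|v].
  by apply: differentiableZl; exact: df.
apply: class_C_eq (IH _ (Df v)) => // x Ux /=.
rewrite [RHS]deriveE; last by apply: differentiableZl; exact: df.
by rewrite diffZl ?deriveE//; exact: df.
Qed.

Lemma class_C_comp_linear V W X k (U : set V) (f : V -> W)
    (L : {linear X -> V}) : open U -> continuous L ->
  class_C k U f -> class_C k (L @^-1` U) (f \o L).
Proof.
move=> oU cL; elim: k f => [|k IH] f.
  by move=> cf x Ux; apply: continuous_comp; [exact: cL|exact: cf].
have dL x : differentiable L x by exact: linear_differentiable.
move=> [df Df]; split=> [x Ux|v].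
  by apply: differentiable_comp => //; exact: df.
apply: class_C_eq (IH _ (Df (L v))) => [|x Ux /=].
  by apply: open_comp => // x _; exact: cL.
rewrite [RHS]deriveE; last by apply: differentiable_comp => //; exact: df.
by rewrite diff_comp//= ?diff_lin ?deriveE//; exact: df.
Qed.
End Calculus.

(** * The constraint system and its solution by Cramer's rule *)

Section Moments.
Context {R : realType} (F n : nat) (M : R).
Local Notation vec := 'cV[R]_(dimN F n).
Local Notation lvl := (@lvl R F).
Implicit Types (u v w h : vec) (k : nat) (l : R).

(** The bilinear form [u^T Gamma^k v] in block coordinates; having all powers of
    [Gamma] in one family lets the three quadratic forms of [Sform], and their
    polarizations, be treated uniformly. *)
Definition wdot k u v : R :=
  \sum_i lvl i ^+ k * \sum_j block u i j 0 * block v i j 0.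

Definition mom k w : R := wdot k w w.

(** The determinant of the linear system for [(1 + 2 mu, 2 lambda)]. *)
Definition disc w : R := mom 0 w * mom 2 w - mom 1 w ^+ 2.

(** The value that the constraints force on [sigma_l^2]. *)
Definition sqcoef l w : R := Sform M l w / disc w.

Definition psi_closed w : vec :=
  \mxcol_(i < (2 * F).+1) (Num.sqrt (sqcoef (lvl i) w) *: block w i).

Lemma block_Gam w i : block (Gam F n *m w) i = lvl i *: block w i.
Proof.
rewrite /block -[w in LHS](submxcolK w) /Gam mul_mxdiag_mxcol mxcolK.
by rewrite mul_scalar_mx.
Qed.

Lemma wdot_Gam k u v : wdot k u (Gam F n *m v) = wdot k.+1 u v.
Proof.
apply: eq_bigr => i _; rewrite block_Gam exprSr -mulrA; congr (_ * _).
by rewrite mulr_sumr; apply: eq_bigr => j _; rewrite [X in _ * X]mxE mulrCA.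
Qed.

Lemma dotE u v : scal1 (u^T *m v) = wdot 0 u v.
Proof.
rewrite -[u in LHS]submxcolK -[v in LHS]submxcolK tr_mxcol mul_mxrow_mxcol.
rewrite /scal1 summxE; apply: eq_bigr => i _; rewrite expr0 mul1r mxE.
by apply: eq_bigr => j _; rewrite mxE.
Qed.

Lemma dot_GamE u v : scal1 (u^T *m Gam F n *m v) = wdot 1 u v.
Proof. by rewrite -mulmxA dotE wdot_Gam. Qed.

Lemma dot_Gam2E u v : scal1 (u^T *m (Gam F n *m Gam F n) *m v) = wdot 2 u v.
Proof. by rewrite -!mulmxA dotE !wdot_Gam. Qed.

Lemma momE k w : mom k w = \sum_i lvl i ^+ k * sqnorm (block w i).
Proof. by []. Qed.

Lemma SformE l w :
  Sform M l w = mom 2 w - (M + l) * mom 1 w + M * l * mom 0 w.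
Proof. by rewrite /Sform dot_Gam2E dot_GamE dotE. Qed.

Lemma manifoldE w : manifold M w <-> mom 0 w = 1 /\ mom 1 w = M.
Proof. by rewrite /manifold /= dotE dot_GamE. Qed.

Lemma tangentE u h : tangent u h <-> wdot 0 u h = 0 /\ wdot 1 u h = 0.
Proof. by rewrite /tangent /= dotE dot_GamE. Qed.

Lemma sqnorm_ge0 m (x : 'cV[R]_m) : 0 <= sqnorm x.
Proof. by apply: sumr_ge0 => j _; exact: sqr_ge0. Qed.

Lemma sqnormZ m (a : R) (x : 'cV[R]_m) : sqnorm (a *: x) = a ^+ 2 * sqnorm x.
Proof.
by rewrite /sqnorm mulr_sumr; apply: eq_bigr => j _; rewrite mxE exprMn.
Qed.

Lemma lvl_bounds i : - F%:R <= lvl i <= F%:R.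
Proof.
rewrite /Defs.lvl lerBlDr lerDl ler0n andbT lerBrDr addrC -lerBrDr opprK -natrD.
by rewrite ler_nat addnn -mul2n -ltnS.
Qed.

Lemma mom0_ge0 w : 0 <= mom 0 w.
Proof. by rewrite momE sumr_ge0// => i _; rewrite mul1r sqnorm_ge0. Qed.

Lemma mom1_bounds w : - F%:R * mom 0 w <= mom 1 w <= F%:R * mom 0 w.
Proof.
rewrite !momE !mulr_sumr; apply/andP; split; apply: ler_sum => i _;
  rewrite expr0 expr1 mul1r ler_wpM2r ?sqnorm_ge0//;
  by case/andP: (lvl_bounds i).
Qed.

Lemma mom2_bounds w : 0 <= mom 2 w <= F%:R ^+ 2 * mom 0 w.
Proof.
rewrite !momE !mulr_sumr sumr_ge0/=; last first.
  by move=> i _; rewrite mulr_ge0 ?sqr_ge0 ?sqnorm_ge0.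
apply: ler_sum => i _; rewrite mul1r ler_wpM2r ?sqnorm_ge0//.
by have /andP[? ?] := lvl_bounds i; nra.
Qed.

Hypothesis hF : (1 <= F)%N.

Let F0 : 0 < F%:R :> R. Proof. by rewrite ltr0n. Qed.

(** Where [Q_l] denotes [Sform M l w], the determinant is the value at the mean
    level [N_1 / N_0] of [N_0 Q_l], and this mean level lies in [[-F, F]]; the
    identity in the proof is the corresponding convex combination of [Q_F] and
    [Q_(-F)], cleared of denominators. *)
Lemma disc_gt0 w : Sset M w -> 0 < disc w.
Proof.
rewrite /Sset /= !SformE => -[Sp Sm].
have N0 := mom0_ge0 w; have /andP[N1l N1u] := mom1_bounds w.
have /andP[N2l N2u] := mom2_bounds w.
(* If [N_0 = 0] then all the moments vanish, and so does [Sform]. *)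
have N0gt : 0 < mom 0 w.
  rewrite lt_neqAle N0 andbT eq_sym; apply/eqP => N00.
  move: N1l N1u N2l N2u Sp; rewrite N00 !mulr0 => N1l N1u N2l N2u.
  have -> : mom 1 w = 0 by apply/le_anti; rewrite N1l N1u.
  have -> : mom 2 w = 0 by apply/le_anti; rewrite N2l N2u.
  by rewrite mulr0 subr0 addr0 ltxx.
rewrite -(pmulr_rgt0 _ (mulr_gt0 (ltr0n R 2) F0)).
have -> : 2 * F%:R * disc w =
  (F%:R * mom 0 w + mom 1 w) *
    (mom 2 w - (M + F%:R) * mom 1 w + M * F%:R * mom 0 w) +
  (F%:R * mom 0 w - mom 1 w) *
    (mom 2 w - (M + - F%:R) * mom 1 w + M * - F%:R * mom 0 w).
  by rewrite /disc; ring.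
(* Both weights are nonnegative with sum [2 F N_0 > 0], so one is positive. *)
have [N1p|N1n] := ltP 0 (F%:R * mom 0 w + mom 1 w).
  by rewrite ltr_pwDl// ?mulr_gt0// mulr_ge0 ?subr_ge0// ltW.
rewrite ltr_wpDl//; first by rewrite mulr_ge0 ?(ltW Sp)//; lra.
by rewrite mulr_gt0//; have := mulr_gt0 F0 N0gt; lra.
Qed.

(** [Sform M l w] is affine in [l], so its values at the levels are convex
    combinations of the values at [F] and [-F]. *)
Lemma Sform_lvl_gt0 w i : Sset M w -> 0 < Sform M (lvl i) w.
Proof.
rewrite /Sset /= => -[Sp Sm]; have /andP[l1 l2] := lvl_bounds i.
rewrite -(pmulr_rgt0 _ (mulr_gt0 (ltr0n R 2) F0)).
have -> : 2 * F%:R * Sform M (lvl i) w = (F%:R + lvl i) * Sform M F%:R w +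
  (F%:R - lvl i) * Sform M (- F%:R) w by rewrite !SformE; ring.
have [lp|ln] := ltP 0 (F%:R + lvl i).
  by rewrite ltr_pwDl// ?mulr_gt0// mulr_ge0 ?subr_ge0// ltW.
rewrite ltr_wpDl//; first by rewrite mulr_ge0 ?(ltW Sp)//; lra.
by rewrite mulr_gt0//; have := F0; lra.
Qed.

Lemma sqcoef_gt0 w i : Sset M w -> 0 < sqcoef (lvl i) w.
Proof. by move=> Sw; rewrite divr_gt0 ?Sform_lvl_gt0 ?disc_gt0. Qed.

(** Cramer's rule solves for [1 + 2 mu] and [2 lambda]; the shift and the
    halvings recover [(mu, lambda)]. *)
Definition cramer w : R * R :=
  (((mom 2 w - M * mom 1 w) / disc w - 1) / 2,
   (M * mom 0 w - mom 1 w) / disc w / 2).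

Lemma sigma_cramer w i : sigma (cramer w) i = Num.sqrt (sqcoef (lvl i) w).
Proof.
rewrite /sigma /sqcoef /cramer SformE /=; congr Num.sqrt.
by set d := (disc w)^-1; field.
Qed.

(** Positivity of the [sigma p i] is what makes the system linear: it rules out
    the truncation of [Num.sqrt] at 0, so that squaring gives back the radicand,
    which is affine in [p]. *)
Lemma radicand_sums (p : R * R) w : (forall i, 0 < @sigma R F p i) ->
  \sum_i sqnorm (block w i) * sigma p i ^+ 2 =
    (1 + 2 * p.1) * mom 0 w + 2 * p.2 * mom 1 w /\
  \sum_i lvl i * sqnorm (block w i) * sigma p i ^+ 2 =
    (1 + 2 * p.1) * mom 1 w + 2 * p.2 * mom 2 w.
Proof.
move=> s0; have sE i : sigma p i ^+ 2 = 1 + 2 * p.1 + 2 * lvl i * p.2.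
  by rewrite sqr_sqrtr// ltW// -sqrtr_gt0; exact: s0.
split; rewrite !momE !mulr_sumr -big_split/=; apply: eq_bigr => i _;
  by rewrite sE; ring.
Qed.

Lemma psi_params_cramer w : Sset M w -> psi_params M w (cramer w).
Proof.
move=> Sw; have s0 i : 0 < @sigma R F (cramer w) i.
  by rewrite sigma_cramer sqrtr_gt0 sqcoef_gt0.
have [E1 E2] := radicand_sums w s0; have D0 := lt0r_neq0 (disc_gt0 Sw).
split=> //; rewrite ?E1 ?E2 /cramer /=; move: D0; rewrite /disc => D0; field;
  by rewrite D0.
Qed.

Lemma psi_params_unique w p : Sset M w -> psi_params M w p -> p = cramer w.
Proof.
move=> Sw [s0]; have [-> ->] := radicand_sums w s0; move=> E1 E2.
have D0 := lt0r_neq0 (disc_gt0 Sw).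
have A : (1 + 2 * p.1) * disc w = mom 2 w - M * mom 1 w.
  transitivity (mom 2 w * ((1 + 2 * p.1) * mom 0 w + 2 * p.2 * mom 1 w) -
    ((1 + 2 * p.1) * mom 1 w + 2 * p.2 * mom 2 w) * mom 1 w).
    by rewrite /disc; ring.
  by rewrite E1 E2 mulr1.
have B : 2 * p.2 * disc w = M * mom 0 w - mom 1 w.
  transitivity (((1 + 2 * p.1) * mom 1 w + 2 * p.2 * mom 2 w) * mom 0 w -
    mom 1 w * ((1 + 2 * p.1) * mom 0 w + 2 * p.2 * mom 1 w)).
    by rewrite /disc; ring.
  by rewrite E1 E2 mulr1.
by rewrite /cramer -A -B [LHS]surjective_pairing; congr pair; field; exact: D0.
Qed.

Lemma psi_params_exists_unique w : Sset M w -> exists! p, psi_params M w p.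
Proof.
move=> Sw; exists (cramer w); split; first exact: psi_params_cramer.
by move=> p /(psi_params_unique Sw).
Qed.

Lemma get_psi_params w : Sset M w -> get (psi_params M w) = cramer w.
Proof.
move=> Sw; apply: psi_params_unique => //.
exact: (getPex (ex_intro _ _ (psi_params_cramer Sw))).
Qed.

Lemma psiE w : Sset M w -> psi M w = psi_closed w.
Proof.
move=> Sw; rewrite /psi get_psi_params//; apply: eq_mxcol => i.
by rewrite sigma_cramer.
Qed.

Lemma psi_manifold w : Sset M w -> manifold M (psi M w).
Proof.
move=> Sw; have [_ E0 E1] := psi_params_cramer Sw.
have sqE i : sqnorm (block (psi M w) i) =
    sqnorm (block w i) * sigma (cramer w) i ^+ 2.
  by rewrite /psi get_psi_params// /block mxcolK sqnormZ mulrC.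
apply/manifoldE; split; rewrite momE; [rewrite -[RHS]E0|rewrite -[RHS]E1].
  by apply: eq_bigr => i _; rewrite mul1r sqE.
by apply: eq_bigr => i _; rewrite sqE mulrA.
Qed.

Lemma Sform_manifold l u : manifold M u -> Sform M l u = disc u.
Proof. by move/manifoldE => [E0 E1]; rewrite SformE /disc E0 E1; ring. Qed.

Hypothesis hMZ : forall z : int, M <> z%:~R.

(** The non-integrality of [M] enters here. All [Sform M l u] agree with the
    determinant, also at the non-level value [l = M], where the form is the sum
    of squares [\sum_l (l - M)^2 |u_l|^2]. Its weights vanish at no integer level [l], and
    some block of [u] is nonzero. *)
Lemma disc_manifold_gt0 u : manifold M u -> 0 < disc u.
Proof.
move=> Mu; rewrite -(Sform_manifold M Mu).
have -> : Sform M M u = \sum_i (lvl i - M) ^+ 2 * sqnorm (block u i).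
  rewrite SformE !momE !mulr_sumr -sumrB -big_split/=.
  by apply: eq_bigr => i _; ring.
have p0 i : 0 <= (lvl i - M) ^+ 2 * sqnorm (block u i).
  by rewrite mulr_ge0 ?sqr_ge0 ?sqnorm_ge0.
rewrite lt_neqAle sumr_ge0// andbT; apply/eqP => /esym/eqP.
rewrite psumr_eq0// => /allP z.
move/manifoldE : Mu => [+ _]; rewrite momE big1 => [/eqP|i _].
  by rewrite eq_sym oner_eq0.
have := z i (mem_index_enum _); rewrite mulf_eq0 => /orP[|/eqP->]; last first.
  by rewrite mulr0.
rewrite sqrf_eq0 subr_eq0 => /eqP lM.
by case: (@hMZ (F%:Z - (i : nat)%:Z)); rewrite -lM /Defs.lvl rmorphB.
Qed.

Lemma manifold_Sset u : manifold M u -> Sset M u.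
Proof.
by move=> Mu; rewrite /Sset /= !Sform_manifold//; split;
  exact: disc_manifold_gt0.
Qed.

Lemma sqcoef_manifold l u : manifold M u -> sqcoef l u = 1.
Proof.
move=> Mu; rewrite /sqcoef Sform_manifold// divff//.
by rewrite gt_eqF// disc_manifold_gt0.
Qed.

Lemma psi_closed_manifold u : manifold M u -> psi_closed u = u.
Proof.
move=> Mu; rewrite -[RHS]submxcolK; apply: eq_mxcol => i.
by rewrite sqcoef_manifold// sqrtr1 scale1r.
Qed.
End Moments.

(** * Smoothness of the closed form and its differential *)

Section Retraction.
Context {R : realType} (F n : nat) (M : R).
Local Notation vec := 'cV[R]_(dimN F n).
Local Notation lvl := (@lvl R F).
Local Notation mom := (@mom R F n).
Local Notation disc := (@disc R F n).
Implicit Types (u v w h : vec) (k : nat) (l : R).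

Lemma class_C_coord d k (U : set 'cV[R]_d) (j : 'I_d) :
  class_C k U (fun x => x j 0 : R).
Proof.
have lin : linear (fun x : 'cV[R]_d => x j 0 : R).
  by move=> a u v; rewrite !mxE.
pose LM := GRing.isLinear.Build _ _ _ _ _ lin.
pose L : {linear 'cV[R]_d -> R} := HB.pack (fun x : 'cV[R]_d => x j 0 : R) LM.
by apply: (@class_C_linear _ _ _ _ _ L); exact: coord_continuous.
Qed.

(** Read off from the entries of the derivative of the identity map. *)
Lemma is_derive_coord d (x h : 'cV[R]_d) j :
  is_derive x h (fun y => y j 0 : R) (h j 0).
Proof.
apply: DeriveDef.
  by apply: diff_derivable; case: (class_C_coord 1 setT j) => /(_ x I).
have := @derive_mx _ _ _ _ (id : 'cV[R]_d -> 'cV[R]_d) x h (@derivable_id _ _ x h).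
by rewrite derive_id => /matrixP/(_ j 0); rewrite mxE => ->.
Qed.

Lemma blockE w i j : block w i j 0 = w (tagnat.Rank i j) 0.
Proof. by rewrite mxE. Qed.

Lemma class_C_mom k m (U : set vec) : open U -> class_C k U (mom m).
Proof.
move=> oU.
apply: (class_C_sum _ oU) => i; apply: class_CM => //.
  exact: class_C_cst.
apply: (class_C_sum _ oU) => j.
have C := @class_C_coord _ k U (tagnat.Rank i j).
apply: class_C_eq (class_CM oU C C) => // w _.
by rewrite /= blockE.
Qed.

Lemma class_C_Sform k l (U : set vec) : open U -> class_C k U (Sform M l).
Proof.
move=> oU; have Cm m := class_C_mom k m oU.
have CZ a m := class_CM oU (class_C_cst k U (a : R)) (Cm m).
apply: class_C_eq (class_CD oU (Cm 2) (class_CD oU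
  (CZ (- (M + l)) 1) (CZ (M * l) 0))) => // w _.
by rewrite SformE /cst /=; ring.
Qed.

Lemma class_C_disc k (U : set vec) : open U -> class_C k U disc.
Proof.
move=> oU; have Cm m := class_C_mom k m oU.
apply: class_C_eq (class_CD oU (class_CM oU (Cm 0) (Cm 2))
  (class_CM oU (class_C_cst k U (-1 : R)) (class_CM oU (Cm 1) (Cm 1)))) => // w _.
by rewrite /disc /cst /=; ring.
Qed.

Lemma open_Sset : open (@Sset R F n M).
Proof.
have cS l : continuous (@Sform R F n M l).
  by move=> w; exact: (@class_C_Sform 0 l setT openT w).
have oS l : open [set w | 0 < @Sform R F n M l w].
  apply: (@open_comp _ _ (@Sform R F n M l) [set x | 0 < x]).
    by move=> w _; exact: cS.
  exact: open_gt.
exact: openI (oS _) (oS _).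
Qed.

Hypothesis hF : (1 <= F)%N.

Lemma psi_closed_coord w j : psi_closed M w j 0 =
  Num.sqrt (sqcoef M (lvl (tagnat.sig1 j)) w) * w j 0.
Proof.
by rewrite mxE [LHS]mxE blockE; congr (_ * w _ 0); exact: tagnat.sig2K.
Qed.

Lemma class_C_sqcoef k l : class_C k (@Sset R F n M) (@sqcoef R F n M l).
Proof.
have oS := open_Sset; apply: (class_CM oS (class_C_Sform k _ oS)).
apply: class_CV => // [w Sw|]; last exact: class_C_disc.
exact: lt0r_neq0 (disc_gt0 hF Sw).
Qed.

(** Expanding along the canonical basis reduces the vector-valued map to its
    scalar coordinates. *)
Lemma class_C_psi_closed k : class_C k (@Sset R F n M) (@psi_closed R F n M).
Proof.
have oS := open_Sset.
have CS : class_C k (@Sset R F n M) (fun w => \sum_j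
  (Num.sqrt (sqcoef M (lvl (tagnat.sig1 j)) w) * w j 0) *: (delta_mx j 0 : vec)).
  apply: (class_C_sum _ oS) => j; apply: class_CZl => //.
  apply: class_CM (class_C_coord k _ j) => //.
  apply: class_C_sqrt => // [w Sw|]; first exact: sqcoef_gt0.
  exact: class_C_sqcoef.
apply: class_C_eq CS => // w _.
rewrite [RHS]matrix_sum_delta; apply: eq_bigr => j _.
by rewrite zmodp.big_ord1 psi_closed_coord.
Qed.

Lemma is_derive_mom m u h : is_derive u h (mom m) (2 * wdot m u h).
Proof.
have -> : mom m = \sum_i (lvl i ^+ m) *: \sum_(j < 2 * n)
    (fun w : vec => w (tagnat.Rank i j) 0 : R) ^+ 2.
  apply/funext => w; rewrite fct_sumE; apply: eq_bigr => i _.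
  rewrite !fctE /GRing.scale /=; congr (_ * _); rewrite fct_sumE.
  by apply: eq_bigr => j _; rewrite blockE.
have dc i (j : 'I_(2 * n)) := is_derive_coord u h (tagnat.Rank i j).
apply: is_derive_eq; rewrite mulr_sumr; apply: eq_bigr => i _.
rewrite /GRing.scale /= mulrCA; congr (_ * _); rewrite mulr_sumr.
by apply: eq_bigr => j _; rewrite !blockE; ring.
Qed.

Hypothesis hMZ : forall z : int, M <> z%:~R.

(** Along [h] the moments [N_0] and [N_1] are stationary, hence [Sform] and
    [disc] both vary like [N_2]. As they also take the same value at [u], their
    quotient is stationary. *)
Lemma is_derive_sqcoef l u h : manifold M u -> tangent u h ->
  is_derive u h (sqcoef M l) 0.
Proof.
move=> Mu /tangentE[h0 h1].
have D0 := is_derive_mom 0 u h; rewrite h0 mulr0 in D0.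
have D1 := is_derive_mom 1 u h; rewrite h1 mulr0 in D1.
have D2 := is_derive_mom 2 u h.
have [m0 m1] := (manifoldE M u).1 Mu.
have dg := lt0r_neq0 (disc_manifold_gt0 hMZ Mu).
have dD : is_derive u h disc (2 * wdot 2 u h).
  have -> : disc = mom 0 * mom 2 - mom 1 ^+ 2 by [].
  by apply: is_derive_eq; rewrite m0 /GRing.scale /=; ring.
have dS : is_derive u h (Sform M l) (2 * wdot 2 u h).
  have -> : @Sform R F n M l = mom 2 - (M + l) *: mom 1 + (M * l) *: mom 0.
    by apply/funext => w; rewrite SformE.
  have := is_deriveD (is_deriveB D2 (is_deriveZ (M + l) D1))
    (is_deriveZ (M * l) D0).
  by rewrite !scaler0 subr0 addr0.
have dV : is_derive u h (fun w => (disc w)^-1) (- (disc u)^-2 * (2 * wdot 2 u h)).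
  apply: DeriveDef; first by apply: derivableV.
  by rewrite deriveV// derive_val.
have -> : @sqcoef R F n M l = Sform M l * (fun w => (disc w)^-1) by [].
apply: is_derive_eq; rewrite Sform_manifold// /GRing.scale /=.
by field.
Qed.

(** By the product rule, a coordinate [sigma_l w_j] has derivative
    [0 * u_j + 1 * h_j], since [sigma_l] is stationary with value 1. *)
Lemma derive_psi_closed u h : manifold M u -> tangent u h ->
  'D_h (@psi_closed R F n M) u = h.
Proof.
move=> Mu Th; have Su := manifold_Sset hMZ Mu.
have [dpsi _] := class_C_psi_closed 1.
rewrite derive_mx; last exact: diff_derivable (dpsi u Su).
apply/matrixP => j z; rewrite ord1 mxE.
have -> : (fun w => psi_closed M w j 0) =
    (fun w => Num.sqrt (sqcoef M (lvl (tagnat.sig1 j)) w)) * (fun w => w j 0 : R).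
  by apply/funext => w; rewrite psi_closed_coord.
have cu : sqcoef M (lvl (tagnat.sig1 j)) u = 1 by exact: sqcoef_manifold.
have dc := is_derive_coord u h j.
have ds : is_derive u h
    (fun w => Num.sqrt (sqcoef M (lvl (tagnat.sig1 j)) w)) 0.
  have c0 : 0 < sqcoef M (lvl (tagnat.sig1 j)) u by rewrite cu.
  have dq : differentiable (sqcoef M (lvl (tagnat.sig1 j))) u.
    by case: (class_C_sqcoef 1 (lvl (tagnat.sig1 j))) => /(_ u Su).
  apply: DeriveDef.
    by apply: diff_derivable; exact: differentiable_sqrt.
  have dr := is_derive_sqcoef (lvl (tagnat.sig1 j)) Mu Th.
  by rewrite derive_sqrt_comp// derive_val mul0r.
by rewrite derive_val cu sqrtr1 scaler0 addr0 scale1r.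
Qed.

(** The first-order expansion of [psi_closed] at [u] holds in all directions;
    restricting it to tangent [h] replaces the differential by the identity. *)
Lemma retr_differential0 u : manifold M u ->
  has_differential0 (tangent u) (retr M u) (idfun : {linear vec -> vec}).
Proof.
move=> Mu; have Su := manifold_Sset hMZ Mu.
have [dpsi _] := class_C_psi_closed 1.
have [_ E] := (diff_locallyP _ _).1 (dpsi u Su).
apply/eqoP => e e0; move/eqaddoP: E => /(_ _ e0) E.
suff H : \forall h \near (0 : vec), tangent u h ->
    `|retr M u h - retr M u 0 - idfun h| <= e * `|h| by exact: H.
have S0 : \forall h \near (0 : vec), Sset M (h + u).
  have : \forall w \near u, Sset M w.
    by apply: open_nbhs_nbhs; split=> //; exact: open_Sset.
  by rewrite (near_shift 0) subr0.
near=> h => Th.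
have <- : (psi_closed M \o shift u - (cst (psi_closed M u) + 'd (psi_closed M) u)) h =
   retr M u h - retr M u 0 - idfun h.
  rewrite !fctE /= -deriveE ?derive_psi_closed//; last exact: dpsi.
  rewrite /retr addr0 [u + h]addrC !psiE//; last by near: h.
  by rewrite opprD addrA.
by near: h.
Unshelve. all: by end_near. Qed.
End Retraction.

Theorem lemma6p7 (R : realType) (F n : nat) (M : R)
    (hF : (1 <= F)%N) (hn : (0 < n)%N) (hn_even : ~~ odd n)
    (hM0 : 0 <= M) (hMF : M < F%:R) (hMZ : forall z : int, M <> z%:~R) :
  (forall w : 'cV[R]_(dimN F n), @Sset R F n M w ->
     exists! p : R * R, @psi_params R F n M w p) /\
  is_retraction (@manifold R F n M) (@tangent R F n)
    (@retr_dom R F n M) (@retr R F n M).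
Proof.
pose V : normedModType R := 'cV[R]_(dimN F n).
split=> [w Sw|]; first exact: psi_params_exists_unique.
have lin : linear (fun p : V * V => p.1 + p.2).
  by move=> a p q /=; rewrite scalerDr addrACA.
pose LM := GRing.isLinear.Build _ _ _ _ _ lin.
pose L : {linear (V * V)%type -> V} := HB.pack (fun p : V * V => p.1 + p.2) LM.
have cL : continuous L by exact: add_continuous.
have oO : open (L @^-1` @Sset R F n M).
  by apply: open_comp => [p _|]; [exact: cL|exact: open_Sset].
split.
- by exists (L @^-1` @Sset R F n M).
- move=> u Mu; split; last by rewrite /= addr0; exact: manifold_Sset.
  by split=> //; apply/tangentE; split; rewrite /wdot big1// => i _;
    rewrite big1 ?mulr0// => j _; rewrite [X in _ * X]mxE [X in _ * X]mxE mulr0.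
- by move=> u xi [_ Su]; exact: psi_manifold.
- move=> p [_ Sp]; exists (L @^-1` @Sset R F n M), (@psi_closed R F n M \o L).
  split=> // [k|q Uq _]; last by rewrite /retr psiE.
  have C := class_C_psi_closed n M hF k.
  exact: (class_C_comp_linear (L := L) (@open_Sset R F n M) cL C).
- move=> u Mu; split; last exact: retr_differential0.
  by rewrite /retr addr0 psiE ?psi_closed_manifold//; exact: manifold_Sset.
Qed.
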